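(* Let $u:A\to B$ be a functor between small categories whose homotopy fibers $A/b$ are homologically trivial for all objects $b$ of $B$. Then $u_*:H_n(A)\to H_n(B)$ is an isomorphism for all $n\ge0$.
   Context: For a functor $u:A\to B$ and an object $b$ of $B$, the homotopy fiber $A/b$ is the category whose objects are pairs $(a,\phi)$ with $a$ an object of $A$ and $\phi:u(a)\to b$ an arrow of $B$, and whose arrows $(a,\phi)\to(a',\phi')$ are arrows $f:a\to a'$ of $A$ with $\phi'u(f)=\phi$. $H_n(C)$ denotes the homology of a small category $C$ with constant coefficients $\mathbb Z$, i.e. the singular homology of its classifying space $BC$. A small category $C$ is homologically trivial if $H_0(C)=\mathbb Z$ and $H_m(C)=0$ for $m>0$. *)

(* Defs.v *)
Set Warnings "-notation-overridden,-ambiguous-paths".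
Set Warnings "-redundant-canonical-projection,-projection-no-head-constant".
From HB Require Import structures.
From mathcomp.multinomials Require Import freeg.
From mathcomp Require Import all_boot all_order all_algebra.
From mathcomp Require Import boolp zify.

Set Implicit Arguments.
Unset Strict Implicit.
Unset Printing Implicit Defensive.

Import GRing.Theory.
Local Open Scope ring_scope.
Local Open Scope quotient_scope.

Record category := Category {
  ob :> Type;
  hom : ob -> ob -> Type;
  idm : forall x, hom x x;
  comp : forall x y z, hom y z -> hom x y -> hom x z;
  comp1m : forall x y (f : hom x y), comp (idm y) f = f;
  compm1 : forall x y (f : hom x y), comp f (idm x) = f;
  compA : forall x y z t (h : hom z t) (g : hom y z) (f : hom x y),
    comp h (comp g f) = comp (comp h g) f
}.
Arguments hom {c} _ _.
Arguments idm {c} x.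
Arguments comp {c x y z} g f.

Record functor (C D : category) := Functor {
  fob :> C -> D;
  fmap : forall x y, hom x y -> hom (fob x) (fob y);
  fmap1 : forall x, fmap (idm x) = idm (fob x);
  fmapM : forall x y z (g : hom y z) (f : hom x y),
    fmap (comp g f) = comp (fmap g) (fmap f)
}.
Arguments fmap {C D} F {x y} f : rename.

Lemma fun_comp_id (C D E : category) (G : functor D E) (F : functor C D) x :
  fmap G (fmap F (idm x)) = idm (G (F x)).
Proof. by rewrite !fmap1. Qed.

Lemma fun_comp_comp (C D E : category) (G : functor D E) (F : functor C D)
    (x y z : C) (g : hom y z) (f : hom x y) :
  fmap G (fmap F (comp g f)) = comp (fmap G (fmap F g)) (fmap G (fmap F f)).
Proof. by rewrite !fmapM. Qed.

Definition fun_comp (C D E : category) (G : functor D E) (F : functor C D) :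
  functor C E :=
  @Functor C E (fun x => G (F x)) (fun x y f => fmap G (fmap F f))
    (fun_comp_id G F) (@fun_comp_comp C D E G F).

Section HomotopyFiber.
Variables (A B : category) (u : functor A B) (b : B).

Definition hofiber_ob := {a : A & hom (u a) b}.

Definition hofiber_hom (x y : hofiber_ob) :=
  {f : hom (projT1 x) (projT1 y) | comp (projT2 y) (fmap u f) = projT2 x}.

Lemma hofiber_hom_eq x y (f g : hofiber_hom x y) :
  proj1_sig f = proj1_sig g -> f = g.
Proof.
by case: f g => [f pf] [g pg] /= efg; subst g; rewrite (Prop_irrelevance pf pg).
Qed.

Lemma hofiber_id_subproof (x : hofiber_ob) :
  comp (projT2 x) (fmap u (idm (projT1 x))) = projT2 x.
Proof. by rewrite fmap1 compm1. Qed.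

Definition hofiber_id (x : hofiber_ob) : hofiber_hom x x :=
  exist _ (idm (projT1 x)) (hofiber_id_subproof x).

Lemma hofiber_comp_subproof (x y z : hofiber_ob)
    (g : hofiber_hom y z) (f : hofiber_hom x y) :
  comp (projT2 z) (fmap u (comp (proj1_sig g) (proj1_sig f))) = projT2 x.
Proof. by rewrite fmapM compA (proj2_sig g) (proj2_sig f). Qed.

Definition hofiber_comp (x y z : hofiber_ob)
    (g : hofiber_hom y z) (f : hofiber_hom x y) : hofiber_hom x z :=
  exist _ (comp (proj1_sig g) (proj1_sig f)) (hofiber_comp_subproof g f).

Lemma hofiber_comp1m x y (f : hofiber_hom x y) :
  hofiber_comp (hofiber_id y) f = f.
Proof. by apply: hofiber_hom_eq; rewrite /= comp1m. Qed.

Lemma hofiber_compm1 x y (f : hofiber_hom x y) :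
  hofiber_comp f (hofiber_id x) = f.
Proof. by apply: hofiber_hom_eq; rewrite /= compm1. Qed.

Lemma hofiber_compA x y z t (h : hofiber_hom z t) (g : hofiber_hom y z)
    (f : hofiber_hom x y) :
  hofiber_comp h (hofiber_comp g f) = hofiber_comp (hofiber_comp h g) f.
Proof. by apply: hofiber_hom_eq; rewrite /= compA. Qed.

Definition hofiber : category :=
  Category hofiber_comp1m hofiber_compm1 hofiber_compA.

End HomotopyFiber.

(* The poset {0 < 1 < ... < n} as a category. *)
Section OrdCat.
Variable n : nat.

Definition ordc_hom (i j : 'I_n.+1) : Type := (i <= j)%N.

Definition ordc_comp (i j k : 'I_n.+1) (g : ordc_hom j k) (f : ordc_hom i j) :
  ordc_hom i k := leq_trans f g.

Definition ordc : category :=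
  @Category 'I_n.+1 ordc_hom (fun i => leqnn i) ordc_comp
    (fun i j f => bool_irrelevance _ _) (fun i j f => bool_irrelevance _ _)
    (fun i j k l h g f => bool_irrelevance _ _).

End OrdCat.

Lemma coface_mono n (i : 'I_n.+2) (j k : 'I_n.+1) :
  (j <= k)%N -> (lift i j <= lift i k)%N.
Proof. by rewrite /= leq_bump2. Qed.

(* The injective monotone map [n] -> [n+1] that misses i. *)
Definition coface n (i : 'I_n.+2) : functor (ordc n) (ordc n.+1) :=
  @Functor (ordc n) (ordc n.+1) (lift i) (@coface_mono n i)
    (fun _ => bool_irrelevance _ _) (fun _ _ _ _ _ => bool_irrelevance _ _).

Definition nerve (C : category) (n : nat) : Type := functor (ordc n) C.

Definition face (C : category) n (i : 'I_n.+2) (s : nerve C n.+1) : nerve C n :=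
  fun_comp s (coface i).

Definition nerve_map (C D : category) (u : functor C D) n (s : nerve C n) :
  nerve D n := fun_comp u s.

Lemma functor_eq (C D : category) (F G : functor C D)
    (e : forall x, F x = G x) :
  (forall x y (f : hom x y),
     ecast z (hom (F x) z) (e y) (fmap F f) =
     ecast z (hom z (G y)) (esym (e x)) (fmap G f)) -> F = G.
Proof.
case: F G e => [F Fm F1 FM] [G Gm G1 GM] /= e.
have eFG : F = G by apply/funext.
subst G => H.
have eFm : Fm = Gm.
  apply: functional_extensionality_dep => x.
  apply: functional_extensionality_dep => y; apply/funext => f.
  have := H x y f.
  by rewrite (Prop_irrelevance (e x) erefl) (Prop_irrelevance (e y) erefl).
subst Gm.
by rewrite (Prop_irrelevance F1 G1) (Prop_irrelevance FM GM).
Qed.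

Lemma ordc_functor_eq m n (F G : functor (ordc m) (ordc n)) :
  (forall i, F i = G i) -> F = G.
Proof. by move=> e; apply: (functor_eq (e := e)) => x y f; apply: bool_irrelevance. Qed.

Lemma fun_compA (C D E T : category) (H : functor E T) (G : functor D E)
    (F : functor C D) : fun_comp H (fun_comp G F) = fun_comp (fun_comp H G) F.
Proof.
pose e x : fun_comp H (fun_comp G F) x = fun_comp (fun_comp H G) F x := erefl.
exact: (functor_eq (e := e)).
Qed.

Lemma face_nerve_map (C D : category) (u : functor C D) n (i : 'I_n.+2)
    (s : nerve C n.+1) : face i (nerve_map u s) = nerve_map u (face i s).
Proof. by rewrite /face /nerve_map fun_compA. Qed.

Lemma face_face (C : category) n (i j : 'I_n.+3) (i' j' : 'I_n.+2)
    (s : nerve C n.+2) :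
  (i < j)%N -> i' = i :> nat -> j = j'.+1 :> nat ->
  face i' (face j s) = face j' (face i s).
Proof.
move=> ij ei ej; rewrite /face -!fun_compA; congr fun_comp.
apply: ordc_functor_eq => k; apply: val_inj => /=.
by rewrite ei ej /bump; lia.
Qed.

(* Homology at Y of X --f--> Y --g--> Z: the quotient of ker g by im f, the   *)
(* latter seen inside ker g.                                                  *)
Section Homology.
Variables (X Y Z : zmodType) (f : {additive X -> Y}) (g : {additive Y -> Z}).

Definition cycle_pred : {pred Y} := fun y => g y == 0.

Lemma cycle_pred_zmod_closed : zmod_closed cycle_pred.
Proof.
split=> [|x y]; rewrite /in_mem /= /cycle_pred ?raddf0 // raddfB.
by move=> /eqP -> /eqP ->; rewrite subr0.
Qed.
HB.instance Definition _ := GRing.isZmodClosed.Build Y cycle_pred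
  cycle_pred_zmod_closed.

Record cycle := Cycle { cycle_val :> Y; _ : cycle_val \in cycle_pred }.
HB.instance Definition _ := [isSub for cycle_val].
HB.instance Definition _ := [Choice of cycle by <:].
HB.instance Definition _ := [SubChoice_isSubZmodule of cycle by <:].

Lemma cycleP (z : cycle) : g (cycle_val z) = 0.
Proof. by case: z => z /= /eqP. Qed.

Definition boundary_pred : {pred cycle} :=
  fun z => `[< exists x, f x = cycle_val z >].

Lemma boundary_pred_zmod_closed : zmod_closed boundary_pred.
Proof.
split=> [|x y]; rewrite /in_mem /= /boundary_pred.
  by apply/asboolP; exists 0; rewrite raddf0.
move=> /asboolP[a ea] /asboolP[c ec]; apply/asboolP; exists (a - c).
by rewrite raddfB ea ec.
Qed.
HB.instance Definition _ := GRing.isZmodClosed.Build cycle boundary_pred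
  boundary_pred_zmod_closed.

Definition homology : zmodType := Quotient.quot boundary_pred.

Definition hclass (z : cycle) : homology := \pi_(Quotient.quot boundary_pred) z.

Lemma hclass_eq (z t : cycle) :
  hclass z = hclass t <-> exists x, f x = cycle_val z - cycle_val t.
Proof.
rewrite /hclass; split=> [/eqP|[x ex]].
  rewrite -Quotient.idealrBE => /asboolP[x ex]; by exists x.
by apply/eqP; rewrite -Quotient.idealrBE; apply/asboolP; exists x.
Qed.

End Homology.

Record complex := Complex {
  chain :> nat -> zmodType;
  diff : forall n, {additive chain n.+1 -> chain n};
  diffK : forall n x, diff n (diff n.+1 x) = 0
}.
Arguments diff K n : rename.

(* The differential leaving degree n; it is 0 for n = 0. *)
Definition diff_out (K : complex) (n : nat) : {additive K n -> K n.-1} :=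
  match n return {additive K n -> K n.-1} with
  | 0 => \0
  | m.+1 => diff K m
  end.

Definition complex_homology (K : complex) (n : nat) : zmodType :=
  homology (diff K n) (diff_out K n).

Record complex_map (K L : complex) := ComplexMap {
  cmap :> forall n, {additive K n -> L n};
  cmap_diff : forall n x, cmap n (diff K n x) = diff L n (cmap n.+1 x)
}.

Section HomologyMap.
Variables (K L : complex) (F : complex_map K L) (n : nat).

Lemma cmap_cycle (z : cycle (diff_out K n)) :
  F n (cycle_val z) \in cycle_pred (diff_out L n).
Proof.
case: z => z; rewrite /in_mem /= /cycle_pred /=.
by case: n z => [|m] z //= /eqP ez; rewrite -cmap_diff ez raddf0.
Qed.

Definition cycle_map (z : cycle (diff_out K n)) : cycle (diff_out L n) :=
  Cycle (cmap_cycle z).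

Definition homology_map_fun (h : complex_homology K n) : complex_homology L n :=
  hclass (diff L n) (cycle_map (repr h)).

Lemma homology_map_funE (z : cycle (diff_out K n)) :
  homology_map_fun (hclass (diff K n) z) = hclass (diff L n) (cycle_map z).
Proof.
have /hclass_eq[x ex] : hclass (diff K n) (repr (hclass (diff K n) z))
                        = hclass (diff K n) z.
  by rewrite {1}/hclass reprK.
by apply/hclass_eq; exists (F n.+1 x); rewrite -cmap_diff ex raddfB.
Qed.

Lemma homology_map_zmod_morphism : zmod_morphism homology_map_fun.
Proof.
move=> x y; elim/quotW: x => x; elim/quotW: y => y.
rewrite -![\pi _]/(hclass (diff K n) _).
have -> : hclass (diff K n) x - hclass (diff K n) y = hclass (diff K n) (x - y).
  by rewrite /hclass raddfB.
rewrite !homology_map_funE /hclass -raddfB; apply: congr1.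
by apply: val_inj; rewrite /= raddfB.
Qed.
HB.instance Definition _ := GRing.isZmodMorphism.Build
  (complex_homology K n) (complex_homology L n) homology_map_fun
  homology_map_zmod_morphism.

Definition homology_map : {additive complex_homology K n -> complex_homology L n}
  := homology_map_fun.

End HomologyMap.

Lemma freeg_additive_ext (K : choiceType) (V : zmodType)
    (f g : {additive {freeg K / int} -> V}) :
  (forall k, f << k >> = g << k >>) -> f =1 g.
Proof.
move=> e x; rewrite -(freeg_sumE x) !raddf_sum; apply: eq_bigr => k _.
by rewrite -[coeff k x]intz -freegU_mulz !raddfMz e.
Qed.

Lemma fglift1 (K : choiceType) (M : lmodType int) (f : K -> M) k :
  fglift f << k >> = f k.
Proof. by rewrite liftU scale1r. Qed.

Section NerveComplex.
Variable C : category.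

(* {freeg K / int} needs a choiceType of generators: {classic T} is T with a  *)
(* choice structure from the axiom of choice.                                 *)
Definition nerve_chain (n : nat) : zmodType := {freeg {classic nerve C n} / int}.

Definition nerve_diff_gen n (s : {classic nerve C n.+1}) : nerve_chain n :=
  \sum_(i < n.+2) << (-1) ^+ i *g (face i s : {classic nerve C n}) >>.

Definition nerve_diff_fun n (c : nerve_chain n.+1) : nerve_chain n :=
  fglift (@nerve_diff_gen n) c.

HB.instance Definition _ n := GRing.isZmodMorphism.Build
  (nerve_chain n.+1) (nerve_chain n) (@nerve_diff_fun n)
  (lift_is_additive (@nerve_diff_gen n)).

Definition nerve_diff n : {additive nerve_chain n.+1 -> nerve_chain n} :=
  @nerve_diff_fun n.

Lemma nerve_diffE n (s : {classic nerve C n.+1}) :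
  nerve_diff n << s >> =
  \sum_(i < n.+2) << (-1) ^+ i *g (face i s : {classic nerve C n}) >>.
Proof. exact: fglift1. Qed.

Lemma freegU_sign n (i : nat) (s : {classic nerve C n}) :
  << (-1) ^+ i *g s >> = << s >> *~ ((-1) ^+ i) :> {freeg {classic nerve C n} / int}.
Proof. by rewrite freegU_mulz intz. Qed.

Lemma nerve_diffK_gen n (s : {classic nerve C n.+2}) :
  nerve_diff n (nerve_diff n.+1 << s >>) = 0.
Proof.
rewrite nerve_diffE raddf_sum /=.
pose F (p : 'I_n.+3 * 'I_n.+2) : nerve_chain n :=
  << (face p.2 (face p.1 s) : {classic nerve C n}) >> *~ ((-1) ^+ (p.1 + p.2)).
rewrite (eq_bigr (fun j => \sum_(i < n.+2) F (j, i))); last first.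
  move=> j _; rewrite freegU_sign raddfMz /= -/(nerve_diff n) nerve_diffE.
  rewrite mulrz_suml; apply: eq_bigr => i _.
  by rewrite freegU_sign -mulrzA /F exprD mulrC.
rewrite pair_bigA /= (eq_bigr F); last by case.
rewrite (bigID (fun p : 'I_n.+3 * 'I_n.+2 => (p.2 < p.1)%N)) /=.
pose h (p : 'I_n.+3 * 'I_n.+2) : 'I_n.+3 * 'I_n.+2 :=
  if (p.2 < p.1)%N then (inord p.2, inord p.1.-1) else (inord p.2.+1, inord p.1).
have hK : involutive h.
  move=> [[j ltj] [i lti]]; rewrite /h /=.
  case: (ltnP i j) => ij /=.
    rewrite !inordK; [|lia..].
    rewrite ifF; last lia.
    congr pair; apply: val_inj; rewrite /= inordK; lia.
  rewrite !inordK; [|lia..].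
  rewrite ifT; last lia.
  congr pair; apply: val_inj; rewrite /= inordK; lia.
rewrite [X in _ + X](reindex_inj (inv_inj hK)) /=.
rewrite [X in _ + X](eq_bigl (fun p : 'I_n.+3 * 'I_n.+2 => (p.2 < p.1)%N)); last first.
  move=> [[j ltj] [i lti]]; rewrite /h /=.
  case: (ltnP i j) => ij /=; rewrite !inordK; lia.
rewrite -big_split /= big1 // => -[j i] /= ij.
rewrite /F /h /= ij /= !inordK; [|have := ltn_ord j; have := ltn_ord i; lia..].
rewrite (@face_face C n (inord i) j i (inord j.-1)).
- have -> : (j + i = (i + j.-1).+1)%N by lia.
  by rewrite exprS mulN1r mulrNz addNr.
- by rewrite inordK //; have := ltn_ord j; lia.
- by rewrite inordK //; have := ltn_ord j; lia.
- by rewrite inordK //; have := ltn_ord j; lia.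
Qed.

Lemma nerve_diffK n (x : nerve_chain n.+2) :
  nerve_diff n (nerve_diff n.+1 x) = 0.
Proof.
exact: (freeg_additive_ext (f := nerve_diff n \o nerve_diff n.+1) (g := \0)
         (@nerve_diffK_gen n)).
Qed.

Definition nerve_complex : complex := Complex nerve_diffK.

End NerveComplex.

Section NerveComplexMap.
Variables (C D : category) (u : functor C D).

Definition nerve_chain_map_fun n (c : nerve_chain C n) : nerve_chain D n :=
  fglift (fun s : {classic nerve C n} =>
            << (nerve_map u s : {classic nerve D n}) >> : {freeg _ / int}) c.

HB.instance Definition _ n := GRing.isZmodMorphism.Build
  (nerve_chain C n) (nerve_chain D n) (@nerve_chain_map_fun n)
  (lift_is_additive _).

Definition nerve_chain_map n : {additive nerve_chain C n -> nerve_chain D n} :=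
  @nerve_chain_map_fun n.

Lemma nerve_chain_mapE n (s : {classic nerve C n}) :
  nerve_chain_map n << s >> = << (nerve_map u s : {classic nerve D n}) >>.
Proof. exact: fglift1. Qed.

Lemma nerve_chain_map_diff n (x : nerve_chain C n.+1) :
  nerve_chain_map n (nerve_diff C n x) = nerve_diff D n (nerve_chain_map n.+1 x).
Proof.
apply: (freeg_additive_ext (f := nerve_chain_map n \o nerve_diff C n)
  (g := nerve_diff D n \o nerve_chain_map n.+1)) => s.
rewrite /= -/(nerve_chain_map _) -/(nerve_diff _ _).
rewrite nerve_chain_mapE !nerve_diffE raddf_sum; apply: eq_bigr => i _.
by rewrite !freegU_sign raddfMz nerve_chain_mapE face_nerve_map.
Qed.

Definition nerve_complex_map :
  complex_map (nerve_complex C) (nerve_complex D) :=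
  @ComplexMap (nerve_complex C) (nerve_complex D) nerve_chain_map
    nerve_chain_map_diff.

End NerveComplexMap.

(* Homology with constant coefficients Z is that of the simplicial set NC:    *)
(* its complex of Z-chains, with differential the alternating sum of faces,   *)
(* also computes the singular homology of the realization BC of NC.           *)
Definition cat_homology (C : category) (n : nat) : zmodType :=
  complex_homology (nerve_complex C) n.

Definition cat_homology_map (A B : category) (u : functor A B) (n : nat) :
  {additive cat_homology A n -> cat_homology B n} :=
  homology_map (nerve_complex_map u) n.

(* H_0(C) = Z is read as: the abelian groups H_0(C) and Z are isomorphic.     *)
Definition homologically_trivial (C : category) : Prop :=
  (exists f : {additive cat_homology C 0 -> int}, bijective f) /\
  (forall m, (0 < m)%N -> forall x : cat_homology C m, x = 0).

(* Main.v *)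
Set Warnings "-notation-overridden,-ambiguous-paths".
From HB Require Import structures.
From mathcomp.multinomials Require Import freeg.
From mathcomp Require Import all_boot all_algebra.
From mathcomp Require Import boolp zify.
Require Import Defs.

Set Implicit Arguments.
Unset Strict Implicit.
Unset Printing Implicit Defensive.

Import GRing.Theory.
Local Open Scope ring_scope.
Local Open Scope quotient_scope.

(** The proof is the method of acyclic models over the base B.

For a category C over B, with structure functor v, the chains C_n(C/b) of the
homotopy fibers form a functor of b which is free: a simplex of C/b is a
simplex s of C together with an arrow v(s_n) -> b, so it is the image, under
that arrow, of one universal simplex living over v(s_n)
([push_slice_lift]). Hence natural maps out of C_n(C/-) lift along every
pointwise surjection ([natfam_lift]): it is enough to lift the values on
universal simplices. As for projective resolutions, induction on the degree
([solve]) then shows that if all fibers D/b of w : D -> B are acyclic, there is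
a natural augmentation-preserving chain map C_*(C/-) -> C_*(D/-)
([natmap_exists]), and any two are naturally homotopic ([natmap_homotopic]).

A natural family descends: since every simplex of C has a universal lift to a
slice, a family of maps C_n(C/b) -> C_m(D/b) induces a map C_n(C) -> C_m(D)
([descend], [descendE]), and this respects differentials, composition and
homotopies.

Now consider A over B through u, and B over itself through the identity. The
slices A/b are acyclic by hypothesis ([trivial_aug_exact]), and the slices B/b
because they have a terminal object ([slice_aug_exact]). This provides a
natural g : C_*(B/-) -> C_*(A/-); on the other side u induces
C_*(A/-) -> C_*(B/-). Both composites are homotopic to the identity by
uniqueness, so the map induced by g is a homotopy inverse of u_*. *)

(** * Additive maps out of free abelian groups *)

Lemma subrACA (V : zmodType) : @interchange V (fun x y => x - y) (fun x y => x - y).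
Proof. by move=> x y z t; rewrite !opprB addrACA [RHS]addrACA [- y - z]addrC. Qed.

Definition additive_of (U V : zmodType) (f : U -> V) (fB : zmod_morphism f) :
  {additive U -> V} := HB.pack f (GRing.isZmodMorphism.Build U V f fB).

(** Extension by linearity takes values in modules over the integers; an
abelian group V becomes one through its alias [zmodule V]. *)
Lemma intmod_lift (T : choiceType) (V : zmodType) (f : T -> V) :
  zmod_morphism (fglift (M := zmodule V) f : {freeg T / int} -> V).
Proof. exact (@lift_is_additive int T (zmodule V) f). Qed.

(** An opaque existence statement keeps simplification from unfolding the
extension by linearity. *)
Lemma lin_ext_exists (T : choiceType) (V : zmodType) (f : T -> V) :
  {g : {additive {freeg T / int} -> V} | forall t, g << t >> = f t}.
Proof.
exists (additive_of (intmod_lift f)) => t.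
exact (@fglift1 T (zmodule V) f t).
Qed.

Definition lin_ext (T : choiceType) (V : zmodType) (f : T -> V) :
  {additive {freeg T / int} -> V} := sval (lin_ext_exists f).

Lemma lin_extE (T : choiceType) (V : zmodType) (f : T -> V) t :
  lin_ext f << t >> = f t.
Proof. exact: (svalP (lin_ext_exists f)). Qed.

(** * Categories over a base: the slices C/b *)

(** When the two functors agree on objects by computation, no transport along
equalities of objects remains. *)
Lemma functor_eq_same_ob (C D : category) (o : C -> D)
    (Fm Gm : forall x y, hom x y -> hom (o x) (o y)) F1 FM G1 GM :
  (forall x y (f : hom x y), Fm x y f = Gm x y f) ->
  @Functor C D o Fm F1 FM = @Functor C D o Gm G1 GM.
Proof.
move=> E; pose e x : Functor F1 FM x = Functor G1 GM x := erefl (o x).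
exact: (functor_eq (e := e)).
Qed.

Section Slices.
Variables (B C : category) (v : functor C B).

Section Push.
Variables (b b' : B) (f : hom b b').

Definition push_ob (x : hofiber v b) : hofiber v b' :=
  existT (fun a => hom (v a) b') (projT1 x) (comp f (projT2 x)).

Lemma push_subproof (x y : hofiber v b) (g : hom x y) :
  comp (projT2 (push_ob y)) (fmap v (proj1_sig g)) = projT2 (push_ob x).
Proof. by rewrite /= -compA (proj2_sig g). Qed.

Definition push_hom (x y : hofiber v b) (g : hom x y) :
  hom (push_ob x) (push_ob y) := exist _ (proj1_sig g) (push_subproof g).

Lemma push_hom1 x : push_hom (idm x) = idm (push_ob x).
Proof. exact: hofiber_hom_eq. Qed.

Lemma push_homM x y z (h : hom y z) (g : hom x y) :
  push_hom (comp h g) = comp (push_hom h) (push_hom g).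
Proof. exact: hofiber_hom_eq. Qed.

Definition push : functor (hofiber v b) (hofiber v b') :=
  Functor push_hom1 push_homM.
End Push.

Definition proj (b : B) : functor (hofiber v b) C :=
  @Functor (hofiber v b) C (@projT1 _ _) (fun x y => @proj1_sig _ _)
    (fun _ => erefl) (fun _ _ _ _ _ => erefl).

Lemma proj_push (b b' : B) (f : hom b b') : fun_comp (proj b') (push f) = proj b.
Proof. exact: functor_eq_same_ob. Qed.

(** The equalities of objects of a slice that occur below have this form: the
underlying object of C is kept and the structure arrow is rewritten.
Transparency lets [hofiber_cast_eq] compute the transport. *)
Lemma hofiber_ob_eq b (t : hofiber v b) (p : hom (v (projT1 t)) b) :
  p = projT2 t -> existT (fun a => hom (v a) b) (projT1 t) p = t :> hofiber v b.
Proof. by case: t p => a q /= p ->. Defined.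

(** Transport along an equality that only rewrites structure arrows does not
change the underlying arrow of C. *)
Lemma hofiber_cast_eq b (t t' : hofiber v b) p p'
    (e : p = projT2 t) (e' : p' = projT2 t')
    (g : hofiber_hom (existT (fun a => hom (v a) b) (projT1 t) p)
                     (existT (fun a => hom (v a) b) (projT1 t') p'))
    (f : hofiber_hom t t') :
  proj1_sig g = proj1_sig f ->
  ecast z (hofiber_hom _ z) (hofiber_ob_eq e') g =
  ecast z (hofiber_hom z _) (esym (hofiber_ob_eq e)) f.
Proof.
case: t t' p p' e e' g f => a q [a' q'] /= p p' e e'.
by subst p p' => g f /= gf; apply: hofiber_hom_eq.
Qed.

Lemma push_comp b b' b'' (g : hom b' b'') (f : hom b b') :
  push (comp g f) = fun_comp (push g) (push f).
Proof.
have E (x : hofiber v b) :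
    comp (comp g f) (projT2 x) = projT2 (fun_comp (push g) (push f) x).
  by rewrite /= compA.
pose e x : push (comp g f) x = fun_comp (push g) (push f) x :=
  @hofiber_ob_eq b'' (push g (push f x)) _ (E x).
apply: (functor_eq (e := e)) => x y h.
exact: (@hofiber_cast_eq b'' (push g (push f x)) (push g (push f y)) _ _
  (E x) (E y)).
Qed.

Lemma ord_le_max n (i : 'I_n.+1) : (i <= (ord_max : 'I_n.+1))%N.
Proof. exact: leq_ord. Qed.

(** The universal lift of a simplex s of C: its vertices s_i are put over
v(s_n) by the arrows v(s_i) -> v(s_n). *)
Section SliceLift.
Variables (n : nat) (s : nerve C n).

Definition to_last (i : ordc n) : hom i (ord_max : ordc n) := ord_le_max i.

Definition slice_ob (i : ordc n) : hofiber v (v (s ord_max)) :=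
  existT (fun a => hom (v a) (v (s ord_max))) (s i) (fmap v (fmap s (to_last i))).

Lemma slice_subproof (i j : ordc n) (f : hom i j) :
  comp (projT2 (slice_ob j)) (fmap v (fmap s f)) = projT2 (slice_ob i).
Proof. by rewrite /= -!fmapM; do 2!congr fmap; apply: bool_irrelevance. Qed.

Definition slice_hom (i j : ordc n) (f : hom i j) :
  hom (slice_ob i) (slice_ob j) := exist _ (fmap s f) (slice_subproof f).

Lemma slice_hom1 i : slice_hom (idm i) = idm (slice_ob i).
Proof. by apply: hofiber_hom_eq; rewrite /= fmap1. Qed.

Lemma slice_homM i j k (h : hom j k) (g : hom i j) :
  slice_hom (comp h g) = comp (slice_hom h) (slice_hom g).
Proof. by apply: hofiber_hom_eq; rewrite /= fmapM. Qed.

Definition slice_lift : nerve (hofiber v (v (s ord_max))) n :=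
  Functor slice_hom1 slice_homM.

End SliceLift.

Lemma proj_slice_lift n (s : nerve C n) : nerve_map (proj _) (slice_lift s) = s.
Proof. by case: s => o sm s1 sM; exact: functor_eq_same_ob. Qed.

(** Freeness of C_n(C/-): a simplex of C/b is the pushforward, along the
structure arrow of its last vertex, of the universal lift of its underlying
simplex. On vertices this is the compatibility of the arrows t_i -> t_n with
the structure arrows. *)
Lemma push_slice_lift b n (t : nerve (hofiber v b) n) :
  nerve_map (push (projT2 (t ord_max))) (slice_lift (nerve_map (proj b) t)) = t.
Proof.
have E i : comp (projT2 (t ord_max)) (fmap v (proj1_sig (fmap t (to_last i))))
           = projT2 (t i) by exact (proj2_sig (fmap t (to_last i))).
pose e i : nerve_map (push (projT2 (t ord_max)))
  (slice_lift (nerve_map (proj b) t)) i = t i := hofiber_ob_eq (E i).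
apply: (functor_eq (e := e)) => i j f.
exact: hofiber_cast_eq.
Qed.

End Slices.

Definition idF (B : category) : functor B B :=
  @Functor B B id (fun _ _ => id) (fun _ => erefl) (fun _ _ _ _ _ => erefl).

(** * Homotopy equivalences induce isomorphisms in homology *)

Section HomologyEquiv.
Variables (K L : complex) (F : complex_map K L) (G : complex_map L K).

Lemma homology_map_bij n :
  (forall z, diff_out K n z = 0 -> exists y, diff K n y = G n (F n z) - z) ->
  (forall z, diff_out L n z = 0 -> exists y, diff L n y = F n (G n z) - z) ->
  bijective (homology_map F n).
Proof.
move=> GF FG; exists (homology_map G n).
  elim/quotW => z; rewrite -![\pi _]/(hclass (diff K n) _) /=.
  by rewrite !homology_map_funE; apply/hclass_eq; apply: GF; exact: cycleP.
elim/quotW => z; rewrite -![\pi _]/(hclass (diff L n) _) /=.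
by rewrite !homology_map_funE; apply/hclass_eq; apply: FG; exact: cycleP.
Qed.
End HomologyEquiv.

(** * Augmented chains *)

Section Aug.
Variable C : category.

Definition eps : {additive nerve_chain C 0 -> int} :=
  lin_ext (fun _ : {classic nerve C 0} => 1).

Definition aug_chain (m : nat) : zmodType :=
  if m is n.+1 then nerve_chain C n else int.

Definition aug_diff (m : nat) : {additive aug_chain m.+1 -> aug_chain m} :=
  match m return {additive aug_chain m.+1 -> aug_chain m} with
  | 0 => eps
  | n.+1 => nerve_diff C n
  end.

Lemma eps_diff x : eps (nerve_diff C 0 x) = 0.
Proof.
apply: (freeg_additive_ext (f := eps \o nerve_diff C 0) (g := \0)) => s.
rewrite /= -/(nerve_diff _ _) nerve_diffE raddf_sum /=.
rewrite (eq_bigr (fun i : 'I_2 => (-1) ^+ i)) => [|i _].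
  by rewrite !big_ord_recl big_ord0.
by rewrite freegU_sign raddfMz lin_extE intz.
Qed.

Lemma aug_diffK m x : aug_diff m (aug_diff m.+1 x) = 0.
Proof. by case: m x => [|n] x; [exact: eps_diff | exact: nerve_diffK]. Qed.

Definition aug_complex : complex := Complex aug_diffK.

(** Exactness in positive degrees, in terms of chains: every cycle of positive
dimension and every 0-chain of augmentation 0 is a boundary. *)
Definition aug_exact : Prop :=
  forall m (x : aug_chain m.+1), aug_diff m x = 0 -> exists y, aug_diff m.+1 y = x.
End Aug.

Section AugMap.
Variables (C D : category) (u : functor C D).

Definition aug_map_fun m : {additive aug_chain C m -> aug_chain D m} :=
  match m return {additive aug_chain C m -> aug_chain D m} with
  | 0 => idfun
  | n.+1 => nerve_chain_map u n
  end.

Lemma eps_map x : eps D (nerve_chain_map u 0 x) = eps C x.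
Proof.
apply: (freeg_additive_ext (f := eps D \o nerve_chain_map u 0)) => s /=.
by rewrite -/(nerve_chain_map _ _) nerve_chain_mapE !lin_extE.
Qed.

Lemma aug_map_diff m x :
  aug_map_fun m (aug_diff C m x) = aug_diff D m (aug_map_fun m.+1 x).
Proof.
case: m x => [|n] x /=; first by rewrite eps_map.
exact: nerve_chain_map_diff.
Qed.

Definition aug_map : complex_map (aug_complex C) (aug_complex D) :=
  @ComplexMap (aug_complex C) (aug_complex D) aug_map_fun aug_map_diff.
End AugMap.

Lemma nerve_chain_map_comp (C D E : category) (G : functor D E)
    (F : functor C D) n x :
  nerve_chain_map (fun_comp G F) n x
  = nerve_chain_map G n (nerve_chain_map F n x).
Proof.
apply: (freeg_additive_ext (f := nerve_chain_map (fun_comp G F) n)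
  (g := nerve_chain_map G n \o nerve_chain_map F n)) => s.
rewrite /= -/(nerve_chain_map _ _) !nerve_chain_mapE.
by rewrite /nerve_map fun_compA.
Qed.

(** * Natural families of maps out of the chains of slices *)

(** A semifunctor from B to chain complexes. *)
Record diagram (B : category) := Diagram {
  diagram_ob :> B -> complex;
  diagram_map : forall b b', hom b b' -> complex_map (diagram_ob b) (diagram_ob b');
  diagram_mapM : forall b b' b'' (g : hom b' b'') (f : hom b b') m x,
    diagram_map (comp g f) m x = diagram_map g m (diagram_map f m x)
}.

Section SliceDiagrams.
Variables (B D : category) (w : functor D B).

Lemma nerve_slices_mapM b b' b'' (g : hom b' b'') (f : hom b b') m x :
  nerve_complex_map (push w (comp g f)) m x
  = nerve_complex_map (push w g) m (nerve_complex_map (push w f) m x).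
Proof.
rewrite /= -/(nerve_chain_map _ _) push_comp.
exact: nerve_chain_map_comp.
Qed.

Definition nerve_slices : diagram B := Diagram nerve_slices_mapM.

Lemma aug_slices_mapM b b' b'' (g : hom b' b'') (f : hom b b') m x :
  aug_map (push w (comp g f)) m x
  = aug_map (push w g) m (aug_map (push w f) m x).
Proof. case: m x => [//|m] x. exact: nerve_slices_mapM. Qed.

Definition aug_slices : diagram B := Diagram aug_slices_mapM.
End SliceDiagrams.

Section NatFam.
Variables (B C : category) (v : functor C B) (K : diagram B).

Local Notation kmap := (diagram_map K).

(** A natural transformation from C_n(C/-) to the degree-m part of K. *)
Record natfam n m := NatFam {
  natfam_fun :> forall b, {additive nerve_chain (hofiber v b) n -> K b m};
  natfamE : forall b b' (f : hom b b') x,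
    natfam_fun b' (nerve_chain_map (push v f) n x) = kmap f m (natfam_fun b x)
}.

Section Lift.
Variables (n m : nat) (q : natfam n m).
Hypothesis q_bound : forall b x, exists y, diff (K b) m y = q b x.

(** C_n(C/-) is projective with respect to pointwise surjections: choose a
preimage for each universal simplex and extend by naturality, using
[push_slice_lift]. *)
Lemma natfam_lift :
  exists h : natfam n m.+1, forall b x, diff (K b) m (h b x) = q b x.
Proof.
have [h0 h0E] : {h0 : forall s : nerve C n, K (v (s ord_max)) m.+1 |
    forall s, diff (K _) m (h0 s)
      = q _ << (slice_lift v s : {classic nerve _ n}) >>}.
  exists (fun s => projT1 (cid (q_bound
    << (slice_lift v s : {classic nerve _ n}) >>))) => s.
  by case: (cid _).
pose hg b (t : {classic nerve (hofiber v b) n}) : K b m.+1 :=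
  kmap (projT2 (t ord_max)) m.+1 (h0 (nerve_map (proj v b) t)).
have hN b b' (f : hom b b') x :
  lin_ext (hg b') (nerve_chain_map (push v f) n x)
  = kmap f m.+1 (lin_ext (hg b) x).
  apply: (freeg_additive_ext (f := lin_ext (hg b') \o nerve_chain_map (push v f) n)
    (g := kmap f m.+1 \o lin_ext (hg b))) => t.
  rewrite [LHS]/= [RHS]/= nerve_chain_mapE !lin_extE /hg.
  (* The arrows phi below live over the last vertex of s, so s can be replaced
     by an equal simplex only together with them; here both last vertices are
     the same by computation and the transport is along reflexivity. *)
  have spread (s s' : nerve C n) (phi : hom (v (s ord_max)) b')
      (phi' : hom (v (s' ord_max)) b') (es : s = s')
      (e : s ord_max = s' ord_max) :
    ecast a (hom (v a) b') e phi = phi' ->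
    kmap phi m.+1 (h0 s) = kmap phi' m.+1 (h0 s').
    by subst s'; rewrite (Prop_irrelevance e erefl) => /= ->.
  have es : nerve_map (proj v b') (nerve_map (push v f) t) = nerve_map (proj v b) t.
    by rewrite /nerve_map fun_compA proj_push.
  rewrite (spread _ (nerve_map (proj v b) t) _ (comp f (projT2 (t ord_max))) es erefl) //.
  exact: diagram_mapM.
exists (NatFam hN) => b x.
apply: (freeg_additive_ext (f := diff (K b) m \o lin_ext (hg b)) (g := q b)) => t.
rewrite [LHS]/= lin_extE /hg.
rewrite -(cmap_diff (kmap (projT2 (t ord_max))) (h0 (nerve_map (proj v b) t))).
rewrite [X in kmap _ m X]h0E -natfamE nerve_chain_mapE push_slice_lift //.
Qed.
End Lift.

(** The inductive construction shared by existence and uniqueness up to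
homotopy: given r with d r = c (r d), build h raising the degree by one with
d h = r - c (h d). For c = 1 the map r is the difference of two chain maps and
h a homotopy. For c = -1 the target is augmented, r is the augmentation in
degree 0 and zero above, and d h = h d makes h a chain map, which
the condition in degree 0 forces to preserve the augmentation. *)
Section Solve.
Variables (c : int) (r : forall n, natfam n n).
Hypothesis K_exact : forall b m (x : K b m.+1),
  diff (K b) m x = 0 -> exists y, diff (K b) m.+1 y = x.
Hypothesis r_bound : forall b x, exists y, diff (K b) 0 y = r 0 b x.
Hypothesis r_diff : forall n b x,
  diff (K b) n (r n.+1 b x) = r n b (nerve_diff _ n x) *~ c.

(** What the next step needs from h: it makes r_{n+1} - c (h d) a cycle, since
d r_{n+1} - c (d h d) = c (r_n d) - c (r_n d). It holds for h_{n+1} as soon as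
d h_{n+1} = r_{n+1} - c (h_n d), because d d = 0. *)
Let good n (h : natfam n n.+1) := forall b x,
  diff (K b) n (h b (nerve_diff _ n x)) = r n b (nerve_diff _ n x).

Lemma solve_step n (h : natfam n n.+1) : good h ->
  {h' : natfam n.+1 n.+2 | good h' & forall b x,
     diff (K b) n.+1 (h' b x) = r n.+1 b x - h b (nerve_diff _ n x) *~ c}.
Proof.
move=> hgood.
pose q0 b x := r n.+1 b x - h b (nerve_diff _ n x) *~ c.
have q0B b : zmod_morphism (q0 b).
  move=> x y; rewrite /q0 (raddfB (r _ b)) (raddfB (nerve_diff _ n)).
  by rewrite (raddfB (h b)) mulrzBl subrACA.
have q0N b b' (f : hom b b') x :
    additive_of (@q0B b') (nerve_chain_map (push v f) n.+1 x)
    = kmap f n.+1 (additive_of (@q0B b) x).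
  rewrite /= /q0 -/(nerve_chain_map _ _) natfamE.
  by rewrite -nerve_chain_map_diff natfamE raddfB raddfMz.
have /cid[h' hh'] : exists h' : natfam n.+1 n.+2, forall b x,
    diff (K b) n.+1 (h' b x) = NatFam q0N b x.
  apply: natfam_lift => b x; apply: K_exact.
  by rewrite /= /q0 raddfB raddfMz /= r_diff hgood subrr.
exists h' => // b x; rewrite hh' /= /q0.
by rewrite -/(nerve_diff _ _) nerve_diffK raddf0 mul0rz subr0.
Qed.

Lemma solve : exists h : forall n, natfam n n.+1,
  (forall b x, diff (K b) 0 (h 0 b x) = r 0 b x) /\
  (forall n b x, diff (K b) n.+1 (h n.+1 b x)
                 = r n.+1 b x - h n b (nerve_diff _ n x) *~ c).
Proof.
have [h0 h0E] := natfam_lift r_bound.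
have h0good : good h0 by move=> b x; rewrite h0E.
pose next n (h : {h : natfam n n.+1 | good h}) : {h : natfam n.+1 n.+2 | good h} :=
  let: exist2 h' gh' _ := solve_step (svalP h) in exist _ h' gh'.
pose hs := nat_rect (fun n => {h : natfam n n.+1 | good h}) (exist _ h0 h0good) next.
exists (fun n => sval (hs n)); split=> [|n] b x; first exact: h0E.
rewrite [hs n.+1]/= /next -/(hs n).
by case: (solve_step (svalP (hs n))) => h' gh' /= ->.
Qed.
End Solve.
End NatFam.

(** * Comparison of slices up to homotopy *)

Section Compare.
Variables (B C D : category) (v : functor C B) (w : functor D B).
Hypothesis w_exact : forall b, aug_exact (hofiber w b).

(** Natural augmentation-preserving chain maps C_*(C/-) -> C_*(D/-). *)
Record natmap := NatMap {
  natmap_fun :> forall n, natfam v (nerve_slices w) n n;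
  natmap_eps : forall b x, eps _ (natmap_fun 0 b x) = eps _ x;
  natmap_diff : forall n b x,
    nerve_diff _ n (natmap_fun n.+1 b x) = natmap_fun n b (nerve_diff _ n x)
}.

Lemma natmap_exists :
  (forall b, exists x : nerve_chain (hofiber w b) 0, eps _ x = 1) -> inhabited natmap.
Proof.
move=> eps1.
pose r0 n b : {additive nerve_chain (hofiber v b) n -> aug_chain (hofiber w b) n} :=
  match n return {additive nerve_chain (hofiber v b) n -> aug_chain (hofiber w b) n}
  with 0 => eps _ | _ => \0 end.
have rN n b b' (f : hom b b') x :
    r0 n b' (nerve_chain_map (push v f) n x)
    = diagram_map (aug_slices w) f n (r0 n b x).
  by case: n x => [|n] x; [exact: eps_map | rewrite /= raddf0].
have [||| h [h0E hSE]] := @solve _ _ v (aug_slices w) (-1)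
  (fun n => @NatFam _ _ v (aug_slices w) n n (r0 n) (@rN n)).
- exact: w_exact.
- move=> b x; have [y ey] := eps1 b; exists (y *~ eps _ x).
  by rewrite raddfMz /= ey intz.
- move=> [|n] b x; first by rewrite /= eps_diff mul0rz raddf0.
  by rewrite /= mul0rz raddf0.
(* Degree n.+1 of the augmented complex is degree n of the nerve complex. *)
pose g n : natfam v (nerve_slices w) n n :=
  @NatFam _ _ v (nerve_slices w) n n (h n) (@natfamE _ _ _ _ _ _ (h n)).
constructor; exists g => [b x|n b x]; first exact: h0E.
by rewrite [LHS]hSE /= mulrN1z opprK add0r.
Qed.

(** The difference of g and g' is a natural chain map whose values on 0-chains
have augmentation 0, hence are boundaries: the induction can start. *)
Lemma natmap_homotopic (g g' : natmap) :
  exists h : forall n, natfam v (nerve_slices w) n n.+1,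
  (forall b x, nerve_diff _ 0 (h 0 b x) = g' 0 b x - g 0 b x) /\
  (forall n b x, nerve_diff _ n.+1 (h n.+1 b x)
                 = g' n.+1 b x - g n.+1 b x - h n b (nerve_diff _ n x)).
Proof.
have rB n b : zmod_morphism (fun x => g' n b x - g n b x).
  by move=> x y; rewrite (raddfB (g' n b)) (raddfB (g n b)) subrACA.
have rN n b b' (f : hom b b') x :
    additive_of (@rB n b') (nerve_chain_map (push v f) n x)
    = diagram_map (nerve_slices w) f n (additive_of (@rB n b) x).
  by rewrite /= -/(nerve_chain_map _ _) !natfamE raddfB.
have [||| h [h0E hSE]] := @solve _ _ v (nerve_slices w) 1 (fun n => NatFam (@rN n)).
- by move=> b m x; apply: (w_exact (m := m.+1)).
- move=> b x; apply: (w_exact (m := 0)).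
  by rewrite /= raddfB !natmap_eps subrr.
- move=> n b x; rewrite /= raddfB -/(nerve_diff _ _).
  by rewrite !natmap_diff.
by exists h; split=> [|n] b x; [exact: h0E | exact: hSE].
Qed.
End Compare.

Lemma natmap_id_natural (B C : category) (v : functor C B) n b b'
    (f : hom b b') (x : nerve_chain (hofiber v b) n) :
  idfun (nerve_chain_map (push v f) n x)
  = diagram_map (nerve_slices v) f n (idfun x).
Proof. by []. Qed.

Definition natmap_id (B C : category) (v : functor C B) : natmap v v :=
  @NatMap _ _ _ v v
    (fun n => @NatFam _ _ v (nerve_slices v) n n (fun b => idfun)
       (@natmap_id_natural B C v n))
    (fun _ _ => erefl) (fun _ _ _ => erefl).

Section NatMapComp.
Variables (B C D E : category).
Variables (v : functor C B) (w : functor D B) (z : functor E B).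
Variables (g : natmap w z) (f : natmap v w).

Lemma natmap_comp_natural n b b' (k : hom b b')
    (x : nerve_chain (hofiber v b) n) :
  (g n b' \o f n b') (nerve_chain_map (push v k) n x)
  = diagram_map (nerve_slices z) k n ((g n b \o f n b) x).
Proof. by rewrite [LHS]/= (natfamE (f n)); exact: (natfamE (g n)). Qed.

Lemma natmap_comp_eps b x : eps _ ((g 0 b \o f 0 b) x) = eps _ x.
Proof. by rewrite /= !natmap_eps. Qed.

Lemma natmap_comp_diff n b x :
  nerve_diff _ n ((g n.+1 b \o f n.+1 b) x) = (g n b \o f n b) (nerve_diff _ n x).
Proof. by rewrite /= [LHS]natmap_diff [X in g n b X]natmap_diff. Qed.

Definition natmap_comp : natmap v z :=
  @NatMap _ _ _ v z
    (fun n => @NatFam _ _ v (nerve_slices z) n n (fun b => g n b \o f n b)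
       (@natmap_comp_natural n))
    natmap_comp_eps natmap_comp_diff.
End NatMapComp.

(** The functor induced by u from A/b to B/b, seen as a natural chain map. *)
Section Base.
Variables (A B : category) (u : functor A B).

Section Fiber.
Variable b : B.
Definition base_ob (x : hofiber u b) : hofiber (idF B) b :=
  existT (fun a => hom (idF B a) b) (u (projT1 x)) (projT2 x).

Definition base_hom (x y : hofiber u b) (f : hom x y) :
  hom (base_ob x) (base_ob y) :=
  exist _ (fmap u (proj1_sig f)) (proj2_sig f).

Lemma base_hom1 x : base_hom (idm x) = idm (base_ob x).
Proof. by apply: hofiber_hom_eq; rewrite /= fmap1. Qed.

Lemma base_homM x y z (h : hom y z) (g : hom x y) :
  base_hom (comp h g) = comp (base_hom h) (base_hom g).
Proof. by apply: hofiber_hom_eq; rewrite /= fmapM. Qed.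

Definition base : functor (hofiber u b) (hofiber (idF B) b) :=
  Functor base_hom1 base_homM.

Lemma proj_base : fun_comp (proj (idF B) b) base = fun_comp u (proj u b).
Proof. exact: functor_eq_same_ob. Qed.
End Fiber.

Lemma base_push b b' (f : hom b b') :
  fun_comp (base b') (push u f) = fun_comp (push (idF B) f) (base b).
Proof. by apply: functor_eq_same_ob => x y g; apply: hofiber_hom_eq. Qed.

Lemma base_natural n b b' (f : hom b b') (x : nerve_chain (hofiber u b) n) :
  nerve_chain_map (base b') n (nerve_chain_map (push u f) n x)
  = diagram_map (nerve_slices (idF B)) f n (nerve_chain_map (base b) n x).
Proof. by rewrite -nerve_chain_map_comp base_push nerve_chain_map_comp. Qed.

Lemma base_eps b x : eps _ (nerve_chain_map (base b) 0 x) = eps _ x.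
Proof. exact: eps_map. Qed.

Lemma base_diff n b x :
  nerve_diff _ n (nerve_chain_map (base b) n.+1 x)
  = nerve_chain_map (base b) n (nerve_diff _ n x).
Proof. by rewrite nerve_chain_map_diff. Qed.

Definition natmap_base : natmap u (idF B) :=
  @NatMap _ _ _ u (idF B)
    (fun n => @NatFam _ _ u (nerve_slices (idF B)) n n
      (fun b => nerve_chain_map (base b) n) (@base_natural n))
    base_eps base_diff.
End Base.

(** * Descent from slices to the categories themselves *)

Section Descent.
Variables (B C D : category) (v : functor C B) (w : functor D B).

Local Notation pi v b n := (nerve_chain_map (proj v b) n).

(** Every simplex of C has a lift to some slice, so a map out of C_n(C) is
determined by its composites with the projections C_n(C/b) -> C_n(C). *)
Lemma slice_ext n (V : zmodType) (f g : {additive nerve_chain C n -> V}) :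
  (forall b x, f (pi v b n x) = g (pi v b n x)) -> f =1 g.
Proof.
move=> fg; apply: freeg_additive_ext => s.
rewrite -(proj_slice_lift v s).
have := fg _ << (slice_lift v s : {classic nerve _ n}) >>.
by rewrite nerve_chain_mapE.
Qed.

(** Lift a simplex universally, apply the family over its last vertex, and
forget the structure arrows. *)
Definition descend n m (F : natfam v (nerve_slices w) n m) :
  {additive nerve_chain C n -> nerve_chain D m} :=
  lin_ext (fun s : {classic nerve C n} =>
    pi w _ m (F _ << (slice_lift v s : {classic nerve _ n}) >>)).

(** Naturality of F reduces the claim to universal simplices, and pushing
forward does not change the underlying chain. *)
Lemma descendE n m (F : natfam v (nerve_slices w) n m) b x :
  descend F (pi v b n x) = pi w b m (F b x).
Proof.
apply: (freeg_additive_ext (f := descend F \o pi v b n)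
  (g := pi w b m \o F b)) => t.
rewrite [LHS]/= [RHS]/= nerve_chain_mapE lin_extE.
have := natfamE F (projT2 (t ord_max))
  << (slice_lift v (nerve_map (proj v b) t) : {classic nerve _ n}) >>.
rewrite nerve_chain_mapE push_slice_lift => ->.
by rewrite -nerve_chain_map_comp proj_push.
Qed.

Lemma descend_diff (g : natmap v w) n x :
  descend (g n) (nerve_diff C n x) = nerve_diff D n (descend (g n.+1) x).
Proof.
apply: (slice_ext (f := descend (g n) \o nerve_diff C n)
  (g := nerve_diff D n \o descend (g n.+1))) => b y.
rewrite [LHS]/= [RHS]/= descendE.
by rewrite -!nerve_chain_map_diff descendE natmap_diff.
Qed.

Definition descend_map (g : natmap v w) :
  complex_map (nerve_complex C) (nerve_complex D) :=
  @ComplexMap (nerve_complex C) (nerve_complex D) (fun n => descend (g n))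
    (descend_diff g).

(** The natural homotopy between g and g' descends to a homotopy of maps
C_*(C) -> C_*(D), which on a cycle bounds the difference. *)
Lemma descend_homotopic (g g' : natmap v w) n (x : nerve_chain C n) :
  (forall b, aug_exact (hofiber w b)) ->
  diff_out (nerve_complex C) n x = 0 ->
  exists y, nerve_diff D n y = descend (g' n) x - descend (g n) x.
Proof.
move=> wE; have [h [h0E hSE]] := natmap_homotopic wE g g'.
have dB m : zmod_morphism (fun x => descend (g' m) x - descend (g m) x).
  by move=> y z; rewrite (raddfB (descend (g' m))) (raddfB (descend (g m))) subrACA.
case: n x => [|n] x dx.
  exists (descend (h 0) x).
  apply: (slice_ext (f := nerve_diff D 0 \o descend (h 0))
    (g := additive_of (@dB 0))) => b y.
  rewrite [LHS]/= [RHS]/= !descendE -nerve_chain_map_diff h0E raddfB //.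
exists (descend (h n.+1) x).
have -> : nerve_diff D n.+1 (descend (h n.+1) x)
    = additive_of (@dB n.+1) x - descend (h n) (nerve_diff C n x).
  have eB : zmod_morphism (fun x => additive_of (@dB n.+1) x
                             - descend (h n) (nerve_diff C n x)).
    move=> y z; rewrite (raddfB (additive_of _)) (raddfB (nerve_diff C n)).
    by rewrite (raddfB (descend (h n))) subrACA.
  apply: (slice_ext (f := nerve_diff D n.+1 \o descend (h n.+1))
    (g := additive_of eB)) => b y.
  rewrite [LHS]/= [RHS]/= -/(nerve_diff _ _) -!nerve_chain_map_diff !descendE.
  by rewrite -nerve_chain_map_diff hSE !raddfB.
by rewrite [nerve_diff _ _ _]dx raddf0 subr0.
Qed.
End Descent.

(** * Homologically trivial categories *)

Section Triv.
Variable C : category.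
Hypothesis hC : homologically_trivial C.

Let cls (x : nerve_chain C 0) : cat_homology C 0 :=
  hclass (diff (nerve_complex C) 0) (Cycle
    (eqxx 0 : x \in cycle_pred (diff_out (nerve_complex C) 0))).

(** The isomorphism f : H_0(C) -> Z of the hypothesis is not given as the
augmentation, so the two are compared. Let x1 be a 0-chain with f[x1] = 1. As f
is injective, x - f[x] x1 is a boundary for every x, whence
eps x = (eps x1) f[x]. A vertex exists, for otherwise H_0(C) = 0, and it has
augmentation 1, so eps x1 is nonzero: eps x = 0 forces f[x] = 0. *)
Lemma trivial_eps_exact :
  (exists x, eps C x = 1) /\
  (forall x, eps C x = 0 -> exists y, nerve_diff C 0 y = x).
Proof.
have [[f [g fK gK]] _] := hC.
have clsB : zmod_morphism (fun x => f (cls x)).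
  move=> x y; rewrite -raddfB; congr (f _); rewrite /cls /hclass -raddfB.
  by congr (\pi _); apply: val_inj.
have cls0 x : f (cls x) = 0 -> exists y, nerve_diff C 0 y = x.
  rewrite -(raddf0 f) => /(can_inj fK).
  have <- : cls 0 = 0.
    rewrite /cls /hclass -[RHS](raddf0 (\pi_(cat_homology C 0))).
    by congr (\pi _); apply: val_inj.
  by move=> /hclass_eq[y /=]; rewrite subr0; exists y.
have [x1 fx1] : exists x, f (cls x) = 1.
  move: (gK 1); elim/quotW: (g 1) => z fz; exists (cycle_val z); rewrite -fz.
  by congr (f _); congr (\pi _); apply: val_inj.
have [s _] : exists s : nerve C 0, True.
  apply: contrapT => noS; suff x10 : x1 = 0.
    by move: fx1; rewrite x10 [f _](raddf0 (additive_of clsB)).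
  apply: (freeg_additive_ext (f := idfun) (g := \0)) => s.
  by case: noS; exists s.
have epsE x : eps C x = eps C x1 * f (cls x).
  have [|y ey] := cls0 (x - x1 *~ f (cls x)).
    rewrite [f _](raddfB (additive_of clsB)) [X in _ - X](raddfMz (additive_of clsB)) /=.
    by rewrite fx1 intz subrr.
  have := eps_diff y; rewrite ey raddfB raddfMz => /eqP; rewrite subr_eq0 => /eqP ->.
  by rewrite -mulrzr intz.
have eps_s : eps C << (s : {classic nerve C 0}) >> = 1 by rewrite lin_extE.
split; first by exists << (s : {classic nerve C 0}) >>.
move=> x; rewrite epsE => /eqP; rewrite mulf_eq0 => /orP[/eqP e1|/eqP]; last exact: cls0.
by move: eps_s; rewrite epsE e1 mul0r.
Qed.

Lemma trivial_aug_exact : aug_exact C.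
Proof.
move=> [|m] x /= dx; first exact: (proj2 trivial_eps_exact).
have cx : x \in cycle_pred (diff_out (nerve_complex C) m.+1).
  by rewrite /in_mem /= /cycle_pred; apply/eqP.
have [_ /(_ m.+1 isT (hclass _ (Cycle cx)))] := hC.
have <- : hclass (diff (nerve_complex C) m.+1)
    (0 : cycle (diff_out (nerve_complex C) m.+1)) = 0 by rewrite /hclass raddf0.
by move=> /hclass_eq[y]; rewrite subr0; exists y.
Qed.
End Triv.

(** * Slices of B: cones over a terminal object *)

(** The poset 0 < ... < n < None, an ordinal with a tagged top element: on it the
cone over a simplex is defined by cases. The ordinal n+1 is mapped to it by
[truncate], and functors into it are determined by their values on objects. *)
Section OptOrd.
Variable n : nat.

Definition ordo_le (o o' : option 'I_n.+1) : bool :=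
  match o, o' with
  | Some i, Some j => (i <= j)%N
  | _, None => true
  | None, Some _ => false
  end.

Definition ordo_hom (o o' : option 'I_n.+1) : Type := ordo_le o o'.

Lemma ordo_refl o : ordo_hom o o.
Proof. by case: o => [i|]; rewrite /ordo_hom /=. Qed.

Lemma ordo_trans o1 o2 o3 : ordo_hom o2 o3 -> ordo_hom o1 o2 -> ordo_hom o1 o3.
Proof.
case: o1 o2 o3 => [i|] [j|] [k|] //; rewrite /ordo_hom /= => jk ij.
exact: leq_trans jk.
Qed.

Definition ordo : category :=
  @Category (option 'I_n.+1) ordo_hom ordo_refl ordo_trans
    (fun _ _ _ => bool_irrelevance _ _) (fun _ _ _ => bool_irrelevance _ _)
    (fun _ _ _ _ _ _ _ => bool_irrelevance _ _).

Lemma ordo_functor_eq (X : category) (F G : functor X ordo) :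
  (forall x, F x = G x) -> F = G.
Proof. by move=> e; apply: (functor_eq (e := e)) => x y f; apply: bool_irrelevance. Qed.

Definition ordo_functor (X : category) (F : X -> option 'I_n.+1)
    (Fm : forall x y : X, hom x y -> ordo_le (F x) (F y)) : functor X ordo :=
  @Functor X ordo F Fm (fun _ => bool_irrelevance _ _)
    (fun _ _ _ _ _ => bool_irrelevance _ _).

Lemma truncate_mono (i j : 'I_n.+2) : (i <= j)%N ->
  ordo_le (insub (i : nat)) (insub (j : nat)).
Proof.
move=> ij; case: insubP => [k _ /= ek|/= ni]; case: insubP => [l /= lj el|_] //=.
  by move: el => /= ->; rewrite ek.
by move: (leq_ltn_trans ij lj); rewrite (negPf ni).
Qed.

Definition truncate : functor (ordc n.+1) ordo :=
  @ordo_functor (ordc n.+1) (fun i => insub (i : nat)) truncate_mono.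

Definition ordo_some : functor (ordc n) ordo :=
  @ordo_functor (ordc n) (fun i => Some i) (fun i j ij => ij).

Definition ordo_none (X : category) : functor X ordo :=
  @ordo_functor X (fun _ => None) (fun _ _ _ => isT).

End OptOrd.

Lemma omap_mono m n (theta : functor (ordc m) (ordc n)) (o o' : ordo m) :
  hom o o' -> ordo_le (omap theta o) (omap theta o').
Proof. by case: o o' => [i|] [j|] // ij; exact (@fmap _ _ theta i j ij). Qed.

Definition ordo_map m n (theta : functor (ordc m) (ordc n)) :
  functor (ordo m) (ordo n) :=
  @ordo_functor n (ordo m) (omap theta) (@omap_mono m n theta).

Section Cone.
Variables (C : category) (t : C) (tm : forall x : C, hom x t).
Hypothesis tmU : forall (x : C) (f g : hom x t), f = g.

Section ConeFunctor.
Variables (n : nat) (s : nerve C n).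

Definition cone_ob (o : ordo n) : C := if o is Some i then s i else t.

Definition cone_hom (o o' : ordo n) : hom o o' -> hom (cone_ob o) (cone_ob o') :=
  match o, o' return @hom (ordo n) o o' -> hom (cone_ob o) (cone_ob o') with
  | Some i, Some j => fun ij => @fmap _ _ s i j ij
  | _, None => fun _ => tm _
  | None, Some _ => fun F => False_rect _ (notF F)
  end.

Lemma cone_hom1 o : cone_hom (idm o) = idm (cone_ob o).
Proof.
case: o => [i|]; last exact (tmU _ _).
by rewrite /= -fmap1; congr fmap; apply: bool_irrelevance.
Qed.

Lemma cone_homM o1 o2 o3 (g : hom o2 o3) (f : hom o1 o2) :
  cone_hom (comp g f) = comp (cone_hom g) (cone_hom f).
Proof.
case: o3 g => [k|] g; last by case: o1 f => [i|] f; exact (tmU _ _).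
case: o2 g f => [j|] g f; last by [].
case: o1 f => [i|] f; last by [].
by rewrite /= -fmapM; congr fmap; apply: bool_irrelevance.
Qed.

Definition cone_functor : functor (ordo n) C := Functor cone_hom1 cone_homM.
Definition cone : nerve C n.+1 := fun_comp cone_functor (truncate n).
End ConeFunctor.

Lemma cone_functor_comp m n (theta : functor (ordc m) (ordc n)) (s : nerve C n) :
  fun_comp (cone_functor s) (ordo_map theta) = cone_functor (fun_comp s theta).
Proof.
pose e o : fun_comp (cone_functor s) (ordo_map theta) o
           = cone_functor (fun_comp s theta) o :=
  match o with Some i => erefl | None => erefl end.
apply: (functor_eq (e := e)) => -[i|] [j|] f //=.
by congr fmap; apply: bool_irrelevance.
Qed.

Lemma face_cone n (s : nerve C n.+1) (i : 'I_n.+3) (i' : 'I_n.+2) :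
  i = i' :> nat -> face i (cone s) = cone (face i' s).
Proof.
move=> ii'; rewrite /face /cone -cone_functor_comp -!fun_compA.
congr fun_comp; apply: ordo_functor_eq => k /=; rewrite /bump ii'.
case: (insubP _ (k : nat)) => [l lk el|] /=.
  have lt : ((i' <= k) + k < n.+2)%N by have := leq_b1 (i' <= k)%N; lia.
  rewrite (insubT (fun x => x < n.+2)%N lt); congr Some.
  by apply: val_inj; rewrite /= /bump el.
move=> kn; rewrite insubN //; have := ltn_ord i'; have := ltn_ord k; lia.
Qed.

Lemma face_cone_max n (s : nerve C n) : face ord_max (cone s) = s.
Proof.
rewrite /face /cone -fun_compA.
have -> : fun_comp (truncate n) (coface ord_max) = ordo_some n.
  apply: ordo_functor_eq => k /=; rewrite /bump leqNgt ltn_ord /= add0n.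
  by rewrite (insubT (fun x => x < n.+1)%N (ltn_ord k)); congr Some; apply: val_inj.
case: s => o sm s1 sM; apply: functor_eq_same_ob => i j f.
by [].
Qed.

Definition tip : nerve C 0 :=
  @Functor (ordc 0) C (fun _ => t) (fun _ _ _ => idm t) (fun _ => erefl)
    (fun _ _ _ _ _ => esym (comp1m _)).

Lemma face0_cone (s : nerve C 0) : face ord0 (cone s) = tip.
Proof.
rewrite /face /cone -fun_compA.
have -> : fun_comp (truncate 0) (coface ord0) = ordo_none 0 (ordc 0).
  by apply: ordo_functor_eq => k /=; rewrite insubN.
by apply: functor_eq_same_ob => i j f; apply: tmU.
Qed.

Definition cone_chain n : {additive nerve_chain C n -> nerve_chain C n.+1} :=
  lin_ext (fun s : {classic nerve C n} =>
    << (cone s : {classic nerve C n.+1}) >> : nerve_chain C n.+1).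

Lemma diff_cone0 x : nerve_diff C 0 (cone_chain 0 x)
  = << (tip : {classic nerve C 0}) >> *~ eps C x - x.
Proof.
have aB : zmod_morphism (fun x : nerve_chain C 0 =>
    << (tip : {classic nerve C 0}) >> *~ eps C x - x : nerve_chain C 0).
  by move=> y z; rewrite (raddfB (eps C)) mulrzBr subrACA.
apply: (freeg_additive_ext (f := nerve_diff C 0 \o cone_chain 0)
  (g := additive_of aB)) => s.
rewrite [LHS]/= [RHS]/= !lin_extE nerve_diffE !big_ord_recl big_ord0 addr0.
rewrite face0_cone (_ : lift ord0 ord0 = ord_max); last exact: val_inj.
rewrite face_cone_max !freegU_sign expr0 expr1.
by rewrite mulrN1z.
Qed.

(** The last face of the cone over s is s itself, the other ones are the cones
over the faces of s. *)
Lemma diff_coneS n x : nerve_diff C n.+1 (cone_chain n.+1 x)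
  = cone_chain n (nerve_diff C n x) + x *~ (-1) ^+ n.+2.
Proof.
have aB : zmod_morphism (fun x : nerve_chain C n.+1 =>
    cone_chain n (nerve_diff C n x) + x *~ (-1) ^+ n.+2).
  move=> y z; rewrite (raddfB (nerve_diff C n)) (raddfB (cone_chain n)) mulrzBl.
  by rewrite opprD addrACA.
apply: (freeg_additive_ext (f := nerve_diff C n.+1 \o cone_chain n.+1)
  (g := additive_of aB)) => s.
rewrite [LHS]/= [RHS]/= -/(nerve_diff _ _) lin_extE !nerve_diffE big_ord_recr /=.
rewrite face_cone_max freegU_sign raddf_sum; congr (_ + _).
apply: eq_bigr => i _; rewrite !freegU_sign raddfMz lin_extE.
by rewrite (@face_cone n s _ i).
Qed.

(** Up to sign, a cycle x is the boundary of the cone over x. *)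
Lemma terminal_aug_exact : aug_exact C.
Proof.
move=> [|m] x /= dx.
  exists (- cone_chain 0 x).
  by rewrite -/(nerve_diff _ _) raddfN diff_cone0 dx mulr0z sub0r opprK.
exists (cone_chain m.+1 x *~ (-1) ^+ m.+2).
rewrite -/(nerve_diff _ _) raddfMz diff_coneS [nerve_diff _ _ _]dx raddf0 add0r.
by rewrite -mulrzA -expr2 sqrr_sign.
Qed.
End Cone.

Lemma slice_aug_exact (B : category) (b : B) : aug_exact (hofiber (idF B) b).
Proof.
pose t : hofiber (idF B) b := existT (fun a => hom (idF B a) b) b (idm b).
pose tm (x : hofiber (idF B) b) : hom x t := exist _ (projT2 x) (comp1m (projT2 x)).
apply: (@terminal_aug_exact _ t tm) => x [f ef] [g eg].
by apply: hofiber_hom_eq; move: ef eg; rewrite /= !comp1m => -> ->.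
Qed.

(** * The comparison along u *)

Lemma descend_id (B C : category) (v : functor C B) n (x : nerve_chain C n) :
  descend (natmap_id v n) x = x.
Proof. by apply: (slice_ext (v := v) (g := idfun)) => b y; rewrite descendE. Qed.

Lemma descend_comp (B C D E : category) (v : functor C B) (w : functor D B)
    (z : functor E B) (g : natmap w z) (f : natmap v w) n (x : nerve_chain C n) :
  descend (natmap_comp g f n) x = descend (g n) (descend (f n) x).
Proof.
apply: (slice_ext (v := v) (g := descend (g n) \o descend (f n))) => b y.
by rewrite [RHS]/= !descendE.
Qed.

Lemma descend_base (A B : category) (u : functor A B) n (x : nerve_chain A n) :
  descend (natmap_base u n) x = nerve_chain_map u n x.
Proof.
apply: (slice_ext (v := u)) => b y; rewrite descendE /= -!/(nerve_chain_map _ _).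
by rewrite -!nerve_chain_map_comp proj_base.
Qed.

Theorem mainTheorem8 (A B : category) (u : functor A B)
    (hu : forall b : B, homologically_trivial (hofiber u b)) (n : nat) :
  bijective (cat_homology_map u n).
Proof.
have uE b : aug_exact (hofiber u b) by exact: trivial_aug_exact.
have [g] := natmap_exists (idF B) uE (fun b => proj1 (trivial_eps_exact (hu b))).
apply: (homology_map_bij (G := descend_map g)) => z dz.
  have := descend_homotopic (natmap_id u) (natmap_comp g (natmap_base u)) uE dz.
  by rewrite descend_comp descend_base descend_id.
have := descend_homotopic (natmap_id (idF B)) (natmap_comp (natmap_base u) g)
  (@slice_aug_exact B) dz.
by rewrite descend_comp descend_base descend_id.
Qed.
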